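(* Consider the functions $J_t$ defined in the context (the finite-horizon value functions for remote estimation of a first-order autoregressive source). For any $t\in\{0,\dots,T\}$: (1) For all $s\in\mathbb S$, $J_t(e,s)$ is even and quasi-convex in $e$. Furthermore, suppose that the channel transition matrix $Q$ is stochastically monotone, i.e., writing $\mathbb S=\{1,\dots,n\}$, for all $i>j$ in $\{1,\dots,n\}$ and all $\ell\in\{0,\dots,n-1\}$, $\sum_{k=\ell+1}^nQ_{ik}\ge\sum_{k=\ell+1}^nQ_{jk}$. Then: (2) For every $e\in\mathbb X$, $J_t(e,s)$ is (weakly) decreasing in $s$. (3) For every $s\in\mathbb S$, the optimal transmission rule $\tilde f_t(e,s)$ is even and quasi-convex in $e$; that is, there is a selection $\tilde f_t(e,s)$ of the arg min over $u$ in the definition of $J_t(e,s)$ with this property.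
   Context: $\mathbb X$ is $\mathbb Z$ or $\mathbb R$; $a\in\mathbb X$; $W$ is an $\mathbb X$-valued random variable with symmetric (about $0$) and unimodal distribution $\mu$ (pdf if $\mathbb X=\mathbb R$, pmf if $\mathbb X=\mathbb Z$). $\mathbb S=\{1,\dots,n\}$ is a finite ordered set of channel states (larger = better) with transition matrix $Q$. $\mathbb U\subset\mathbb R_{\ge0}$ is either a finite set $\{0,u_{(1)},\dots,u_{\max}\}$ or $[0,u_{\max}]$. The packet-drop probability $p(s,u)\in[0,1]$ is weakly decreasing in $u$ and decreasing in $s$, with $p(s,0)=1$. The transmission cost $\lambda$ is weakly increasing on $\mathbb U$ with $\lambda(0)=0$, $\lambda(u_{\max})<\infty$; the distortion $d:\mathbb X\to\mathbb R$ is even and quasi-convex with $d(0)=0$. Value functions: $J_{T+1}\equiv0$ and for $t=T,\dots,0$, $e\in\mathbb X$, $s\in\mathbb S$, $$J_t(e,s)=\min_{u\in\mathbb U}\Big\{\lambda(u)+\sum_{s'\in\mathbb S}Q_{ss'}\Big[p(s',u)d(e)+p(s',u)\,\mathbb E[J_{t+1}(ae+W,s')]+(1-p(s',u))\,\mathbb E[J_{t+1}(W,s')]\Big]\Big\},$$ and $\tilde f_t(e,s)$ denotes an arg min. (This is the dynamic program for the transmitter when the state is $(E_t,S_{t-1})$, $E_t$ being the error between the source and the receiver's prediction, and the receiver uses the Kalman-like estimator.) The minima are understood to be attained. A function on $\mathbb X$ is quasi-convex if its sublevel sets are intervals of $\mathbb X$. *)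

(* Defs.v *)
From HB Require Import structures.
From mathcomp Require Import all_boot all_order all_algebra.
From mathcomp Require Import all_classical all_reals all_analysis.

Set Implicit Arguments.
Unset Strict Implicit.
Unset Printing Implicit Defensive.

Import Order.TTheory GRing.Theory Num.Theory.
Import numFieldNormedType.Exports.

Local Open Scope classical_set_scope.
Local Open Scope ring_scope.

Inductive alphabet := Integers | Reals.

Definition carrier (R : realType) (x : alphabet) : realDomainType :=
  match x with Integers => int | Reals => R end.

Definition even_fun (X : zmodType) (Y : Type) (g : X -> Y) : Prop :=
  forall x, g (- x) = g x.

Definition quasi_convex (X : realDomainType) (disp : Order.disp_t)
    (Y : porderType disp) (g : X -> Y) : Prop :=
  forall r : Y, is_interval [set x | (g x <= r)%O].

Definition symmetric_unimodal (X R : realDomainType) (f : X -> R) : Prop :=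
  [/\ even_fun f,
      forall x y, x <= y -> y <= 0 -> f x <= f y
    & forall x y, 0 <= x -> x <= y -> f y <= f x].

Section Noise.
Context (R : realType) (d : measure_display) (Omega : measurableType d)
        (P : probability Omega R).

Definition is_pdf_of (W : Omega -> R) (f : R -> R) : Prop :=
  [/\ measurable_fun setT W, measurable_fun setT f, forall x, 0 <= f x
    & forall A : set R, measurable A ->
        P (W @^-1` A) = (\int[lebesgue_measure]_(x in A) (f x)%:E)%E].

Definition is_pmf_of (W : Omega -> int) (f : int -> R) : Prop :=
  forall k : int, measurable (W @^-1` [set k]) /\
                  P (W @^-1` [set k]) = (f k)%:E.

Definition symmetric_unimodal_noise (x : alphabet) :
    (Omega -> carrier R x) -> Prop :=
  match x return (Omega -> carrier R x) -> Prop with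
  | Integers => fun W => exists2 f, is_pmf_of W f & symmetric_unimodal f
  | Reals => fun W => exists2 f, is_pdf_of W f & symmetric_unimodal f
  end.

End Noise.

Definition power_levels (R : realType) (U : set R) : Prop :=
  (exists2 umax : R, 0 <= umax & U = `[0, umax]%classic) \/
  [/\ finite_set U, U 0 & forall u, U u -> 0 <= u].

(* The states 1, ..., n are represented by 0, ..., n - 1. *)
Definition transition_matrix (R : realType) (n : nat) (Q : 'M[R]_n) : Prop :=
  (forall i j, 0 <= Q i j) /\ (forall i, \sum_j Q i j = 1).

(* The tail k = l + 1, ..., n (with 0 <= l <= n - 1) becomes k >= l after the
   shift of the states. *)
Definition stochastically_monotone (R : realType) (n : nat) (Q : 'M[R]_n) :
    Prop :=
  forall i j : 'I_n, (j < i)%N -> forall l : 'I_n,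
    \sum_(k < n | (l <= k)%N) Q j k <= \sum_(k < n | (l <= k)%N) Q i k.

Definition drop_probability (R : realType) (n : nat) (U : set R)
    (p : 'I_n -> R -> R) : Prop :=
  [/\ forall s u, U u -> 0 <= p s u <= 1,
      forall s u v, U u -> U v -> u <= v -> p s v <= p s u,
      forall (s s' : 'I_n) u, U u -> (s <= s')%N -> p s' u <= p s u
    & forall s, p s 0 = 1].

Definition transmission_cost (R : realType) (U : set R) (lambda : R -> R) :
    Prop :=
  (forall u v, U u -> U v -> u <= v -> lambda u <= lambda v) /\ lambda 0 = 0.

Definition distortion (X R : realDomainType) (dist : X -> R) : Prop :=
  [/\ even_fun dist, quasi_convex dist & dist 0 = 0].

Definition is_arg_min (R : realType) (U : set R) (H : R -> \bar R) (u : R) :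
    Prop :=
  U u /\ forall v, U v -> (H u <= H v)%E.

Section DynamicProgram.
Context (R : realType) (X : realDomainType) (n : nat) (U : set R)
        (d : measure_display) (Omega : measurableType d)
        (P : probability Omega R) (a : X) (W : Omega -> X) (Q : 'M[R]_n)
        (p : 'I_n -> R -> R) (lambda : R -> R) (dist : X -> R).

(* Costs live in [0, +oo], so that no integrability has to be assumed; the
   convention 0 * +oo = 0 is the one of \bar R. *)
Definition bellman (J : X -> 'I_n -> \bar R) (e : X) (s : 'I_n) (u : R) :
    \bar R :=
  ((lambda u)%:E +
   \sum_(s' < n) (Q s s')%:E *
     ((p s' u * dist e)%R%:E
      + (p s' u)%:E * (\int[P]_w J (a * e + W w)%R s')
      + (1 - p s' u)%R%:E * (\int[P]_w J (W w) s')))%E.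

(* Indexed by the number of remaining stages. *)
Fixpoint cost_to_go (k : nat) (e : X) (s : 'I_n) : \bar R :=
  match k with
  | 0%N => 0%E
  | k'.+1 => ereal_inf (bellman (cost_to_go k') e s @` U)
  end.

Definition value_function (T t : nat) : X -> 'I_n -> \bar R :=
  cost_to_go (T.+1 - t).

Definition objective (T t : nat) : X -> 'I_n -> R -> \bar R :=
  bellman (value_function T t.+1).

Lemma value_function_end (T : nat) (e : X) (s : 'I_n) :
  value_function T T.+1 e s = 0%E.
Proof. by rewrite /value_function subnn. Qed.

Lemma value_functionE (T t : nat) (e : X) (s : 'I_n) : (t <= T)%N ->
  value_function T t e s = ereal_inf (objective T t e s @` U).
Proof. by move=> tT; rewrite /objective /value_function subSn// subSS. Qed.

(* At an arg min the infimum above is a minimum. *)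
Lemma value_function_min (T t : nat) (e : X) (s : 'I_n) (u : R) :
  (t <= T)%N -> is_arg_min U (objective T t e s) u ->
  value_function T t e s = objective T t e s u.
Proof.
move=> tT [Uu umin]; rewrite value_functionE//; apply/eqP.
rewrite eq_le; apply/andP; split; first by apply: ereal_inf_lbound; exists u.
by apply: le_ereal_inf_tmp => _ [v Uv <-]; exact: umin.
Qed.

End DynamicProgram.

(* Main.v *)
(* J is even and quasi-convex exactly when it is nondecreasing in |e|.
   Averaging over symmetric unimodal noise preserves this: by layer cake it
   suffices that P(y + W in S) decreases with |y| for a symmetric interval S.
   For a pdf f this is a bathtub argument: when 0 <= y <= y', every point of
   (S - y) \ (S - y') is at least as close to 0 as every point of
   (S - y') \ (S - y), and the two differences have the same Lebesgue measure.
   For a pmf, moving the window S - y by one step trades one value of the pmf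
   for a smaller one.

   Monotonicity in s combines stochastic dominance for Q (Abel summation) with
   E[J(W,s)] <= E[J(ae+W,s)], which makes the stage cost increase with the drop
   probability.  The stage cost is submodular in (|e|, u), so the sets of
   minimizers are ordered, and a suitable selection is monotone. *)

Require Import Defs.
From HB Require Import structures.
From mathcomp Require Import all_boot all_order all_algebra.
From mathcomp Require Import all_classical all_reals all_analysis.
From mathcomp Require Import measurable_realfun wochoice zify ring lra.
Import Order.TTheory GRing.Theory Num.Theory.
Import numFieldNormedType.Exports.
Local Open Scope classical_set_scope.
Local Open Scope ring_scope.

(** * Lebesgue measure and tail integrals *)

Section LebesgueInvariance.
Context {R : realType}.
Notation mu := (@lebesgue_measure R).

(** The half-open intervals determine Lebesgue measure, and the pushforward by a translation agrees
    with it on them. *)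
Lemma lebesgue_measure_shift (y : R) (A : set R) : measurable A ->
  mu [set w | A (y + w)] = mu A.
Proof.
move=> mA.
pose shift_y (w : measurableTypeR R) : measurableTypeR R := y + w.
have mf : measurable_fun setT shift_y by apply: measurable_funD.
rewrite -[LHS]/(pushforward mu shift_y A); apply/esym.
apply: (@lebesgue_measure_unique R (pushforward mu _)) => // _ [[a b] /= _ <-].
rewrite /pushforward /shift_y (_ : _ @^-1` _ = `]a - y, b - y]%classic); last first.
  by apply/seteqP; split => w /=; rewrite !in_itv/= => /andP[? ?];
    apply/andP; split; lra.
rewrite !lebesgue_measure_itv/= !lte_fin; congr (if _ then _ else _).
  by apply/idP/idP => ?; lra.
by rewrite -!EFinB; congr EFin; lra.
Qed.

Lemma ge0_integral_opp (f : R -> \bar R) (A : set R) : measurable A ->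
  measurable_fun setT f -> (forall x, 0 <= f x)%E ->
  (\int[mu]_(x in -%R @^-1` A) f (- (x : R))%R = \int[mu]_(x in A) f x)%E.
Proof.
move=> mA mf f0.
pose opp : measurableTypeR R -> measurableTypeR R := -%R.
have mN : measurable_fun setT opp by exact: oppr_measurable.
have muN B : measurable B -> mu B = pushforward mu opp B.
  move=> mB.
  apply: (@lebesgue_measure_unique R (pushforward mu _)) => //.
  move=> _ [[a b] /= _ <-].
  (* Reflection exchanges the open and the closed end of the interval, which leaves its length
     unchanged. *)
  rewrite /pushforward /opp (_ : _ @^-1` _ = `[- b, - a[%classic); last first.
    by apply/seteqP; split => w /=; rewrite !in_itv/= => /andP[? ?];
      apply/andP; split; lra.
  rewrite !lebesgue_measure_itv/= !lte_fin; congr (if _ then _ else _).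
    by apply/idP/idP => ?; lra.
  by rewrite -!EFinB; congr EFin; lra.
rewrite -[LHS](@ge0_integral_pushforward _ _ (measurableTypeR R)
  (measurableTypeR R) R _ mN mu A f)//=; last 1 first.
  exact: measurable_funTS.
by apply: eq_measure_integral => B mB _; exact/esym/muN.
Qed.

End LebesgueInvariance.

(** Layer cake: the expectation of a nonnegative variable is the integral of its tail. The formula
    is applied to the truncations at [n], which are real valued, and monotone convergence then
    allows the value +oo. *)
Lemma le_integral_tail {d} {T : measurableType d} {R : realType}
    (P : probability T R) (X Y : T -> \bar R) :
  measurable_fun setT X -> measurable_fun setT Y ->
  (forall w, 0 <= X w)%E -> (forall w, 0 <= Y w)%E ->
  (forall r : R, P [set w | r%:E < X w] <= P [set w | r%:E < Y w])%E ->
  (\int[P]_w X w <= \int[P]_w Y w)%E.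
Proof.
move=> mX mY X0 Y0 XY.
pose tr (Z : T -> \bar R) (n : nat) w := fine (mine (Z w) n%:R%:E).
have trE Z n w : (0 <= Z w)%E -> ((tr Z n w)%:E = mine (Z w) n%:R%:E)%E.
  by rewrite /tr; case: (Z w) => [z|//|//] z0; rewrite /mine; case: ifPn.
have mtr Z n : measurable_fun setT Z -> measurable_fun setT (tr Z n).
  move=> mZ; apply: measurableT_comp => //; exact: measurable_mine.
have tailE (Z : T -> \bar R) n (mZ : measurable_fun setT Z) (r : R) :
    (forall w, 0 <= Z w)%E ->
    (@ccdf _ _ _ P (mfun_Sub (mem_set (mtr Z n mZ))) r =
     if (r < n%:R)%R then P [set w | r%:E < Z w] else 0)%E.
  move=> Z0; rewrite /ccdf /distribution /pushforward.
  rewrite (_ : _ @^-1` _ = [set w | r%:E < mine (Z w) n%:R%:E]%E); last first.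
    by apply/seteqP; split => w /=; rewrite in_itv/= andbT -lte_fin trE.
  case: ifPn => rn.
    by congr (P _); apply/seteqP; split => w /=;
      rewrite lt_min lte_fin rn andbT.
  rewrite (_ : [set _ | _] = set0) ?measure0//.
  by apply/seteqP; split => w //=; rewrite lt_min lte_fin (negbTE rn) andbF.
have cvgtr Z : measurable_fun setT Z -> (forall w, 0 <= Z w)%E ->
    (\int[P]_w (tr Z n w)%:E @[n --> \oo] --> \int[P]_w Z w)%E.
  move=> mZ Z0.
  have -> : (\int[P]_w Z w = \int[P]_w limn (fun n => (tr Z n w)%:E))%E.
    apply: eq_integral => w _; apply/esym/cvg_lim => //.
    under eq_fun do rewrite trE//.
    (* At a finite value the truncations are eventually constant; at +oo they are [n] itself. *)
    case: (Z w) (Z0 w) => [z z0|_|//]; last first.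
      under eq_fun do rewrite min_r ?leey//.
      exact/cvgenyP/cvg_id.
    apply: cvg_near_cst; exists (Num.bound z) => //= n zn.
    rewrite min_l// lee_fin (le_trans (ltW (archi_boundP _)))//.
    by rewrite ler_nat.
  apply: cvg_monotone_convergence => //.
  - by move=> n; apply/measurable_EFinP; exact: (mtr _ n mZ).
  - by move=> n w _; rewrite trE// le_min Z0/= lee_fin.
  - move=> w _ m n mn; rewrite !trE// le_min ge_min lexx/=.
    by rewrite ge_min lee_fin ler_nat mn orbT.
have trle n : (\int[P]_w (tr X n w)%:E <= \int[P]_w (tr Y n w)%:E)%E.
  have := @ge0_expectation_ccdf _ _ _ P (mfun_Sub (mem_set (mtr X n mX))).
  have := @ge0_expectation_ccdf _ _ _ P (mfun_Sub (mem_set (mtr Y n mY))).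
  rewrite !expectation_def /= => ->; last first.
    by move=> w; rewrite -lee_fin trE// le_min Y0/= lee_fin.
  move=> ->; last first.
    by move=> w; rewrite -lee_fin trE// le_min X0/= lee_fin.
  apply: ge0_le_integral => //.
  - by apply: measurable_funTS; exact: ccdf_measurable.
  - by apply: measurable_funTS; exact: ccdf_measurable.
  by move=> r _; rewrite !tailE//; case: ifP.
by apply: (lee_cvg_to (cvgtr X mX X0) (cvgtr Y mY Y0)); near=> n; exact: trle.
Unshelve. all: by end_near. Qed.

(** * Symmetric unimodal noise *)

(** These are the intervals centred at 0, with or without endpoints, bounded or not, and the empty
    set: the sublevel sets of even quasi-convex functions. *)
Definition radial_set {X : realDomainType} (S : set X) : Prop :=
  forall z z' : X, `|z| <= `|z'| -> S z' -> S z.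

Lemma symmetric_unimodal_le {X R : realDomainType} (f : X -> R) (x y : X) :
  symmetric_unimodal f -> `|x| <= `|y| -> f y <= f x.
Proof.
move=> [fN _ fle] xy.
have fnorm z : f `|z| = f z by case: (ger0P z).
by rewrite -(fnorm x) -(fnorm y); exact: fle.
Qed.

(** A point between [u] and [v] is no farther from [- y] than the farther of the two. *)
Lemma radial_set_interval {X : realDomainType} (S : set X) (y : X) :
  radial_set S -> is_interval [set w | S (y + w)].
Proof.
move=> rS u v /= Su Sv w /andP[uw wv].
have [wu|uw'] := leP `|y + w| `|y + u|; first exact: rS wu Su.
apply: rS Sv; have [yw|yw] := leP 0 (y + w).
  by rewrite ger0_norm// (le_trans _ (ler_norm _))// lerD2l.
have := le_lt_trans (ler_norm (- (y + u))); rewrite normrN => /(_ _ uw').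
by rewrite ltr0_norm// ltrN2 ltrD2l ltNge uw.
Qed.

(** * Noise with a density *)

Section PdfNoise.
Context {R : realType}.
Notation mu := (@lebesgue_measure R).
Variables (f : R -> R) (S : set R).
Hypotheses (fm : measurable_fun setT f) (f0 : forall x, 0 <= f x)
  (fu : symmetric_unimodal f) (rS : radial_set S).
Let A y := [set w | S (y + w)].

Let mA y : measurable (A y).
Proof. by apply: is_interval_measurable; exact: radial_set_interval. Qed.

Let mf : measurable_fun setT (EFin \o f).
Proof. exact/measurable_EFinP. Qed.

Let integral_even y :
  (\int[mu]_(w in A (- y)) (f w)%:E = \int[mu]_(w in A y) (f w)%:E)%E.
Proof.
rewrite -[RHS](ge0_integral_opp (EFin \o f)) //.
have [fN _ _] := fu.
rewrite (_ : -%R @^-1` A y = A (- y)).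
  by apply: eq_integral => w _ /=; rewrite fN.
by apply/seteqP; split => w /=; apply: rS; rewrite -normrN opprD opprK.
Qed.

Let integral_ge0_le y y' : 0 <= y -> y <= y' ->
  (\int[mu]_(w in A y') (f w)%:E <= \int[mu]_(w in A y) (f w)%:E)%E.
Proof.
move=> y0 yy'.
have [->|AA'] := pselect (A y' = A y); first by [].
(* A point outside [S] bounds [S], so the windows have finite measure and the measure of their
   intersection can be cancelled. *)
have [z0 Sz0] : exists z0, ~ S z0.
  apply: contra_notP AA' => /forallNP ST.
  by apply/seteqP; split => w _; apply: contrapT; exact: ST.
have mS : measurable S.
  by rewrite (_ : S = A 0)//; apply/seteqP; split => w; rewrite /A/= add0r.
have muS : (mu S < +oo)%E.
  apply: (@le_lt_trans _ _ (mu `[- `|z0|, `|z0|]%classic)).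
    rewrite le_measure ?inE// => w Sw; rewrite /= in_itv/= -ler_norml leNgt.
    by apply/negP => /ltW zw; exact/Sz0/(rS _ _ zw).
  by rewrite lebesgue_measure_itv/=; case: ifP => // _; rewrite -EFinB ltry.
have muA z : mu (A z) = mu S by exact: lebesgue_measure_shift.
have muD : mu (A y' `\` A y) = mu (A y `\` A y').
  have := muA y'; rewrite -(muA y).
  rewrite (measureDI mu (mA y') (mA y)) (measureDI mu (mA y) (mA y')) setIC.
  have Ifin : mu (A y `&` A y') \is a fin_num.
    rewrite ge0_fin_numE//; apply: le_lt_trans muS.
    rewrite -(muA y); apply: le_measure; rewrite ?inE.
    - exact: (measurableI _ _ (mA y) (mA y')).
    - exact: mA.
    - exact: subIsetl.
  by move=> /(congr1 (fun z => z - mu (A y `&` A y'))%E); rewrite !addeK.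
have mD z z' : measurable (A z `\` A z') by exact: measurableD (mA z) (mA z').
have mI z z' : measurable (A z `&` A z') by exact: measurableI (mA z) (mA z').
have splitA z z' : (\int[mu]_(w in A z) (f w)%:E =
    \int[mu]_(w in A z `&` A z') (f w)%:E +
    \int[mu]_(w in A z `\` A z') (f w)%:E)%E.
  rewrite -[in LHS](setUIDK (A z) (A z')).
  apply: (@ge0_integral_setU _ _ R mu _ _ (mI z z') (mD z z') (EFin \o f)).
  - exact: (measurable_funTS mf).
  - by move=> w _; rewrite lee_fin.
  by apply/disj_set2P/seteqP; split => w //= [[_ ?] [_]].
rewrite (splitA y' y) (splitA y y') [A y' `&` _]setIC; apply: leeD => //.
have [D0|/eqP/set0P[v0 Dv0]] := pselect (A y `\` A y' = set0).
  rewrite D0 integral_set0 null_set_integral//; first exact: mD.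
    exact: (measurable_funTS mf).
  by rewrite [LHS]muD D0 measure0.
(* [v] is strictly closer than [w] to [- y], and [w] strictly closer than [v] to [- y']. If [v < w],
   their midpoint would lie above [- y] and below [- y'], against [y <= y']. If [w < v], then
   [v + w < - 2 y <= 0], so [w] is negative and [|v| <= |w|]. *)
have bnd w v : (A y' `\` A y) w -> (A y `\` A y') v -> f w <= f v.
  move=> [Aw nAw] [Av nAv]; apply: symmetric_unimodal_le fu _.
  have : `|y + v| < `|y + w|.
    by rewrite ltNge; apply/negP => /rS wv; exact/nAw/wv.
  have : `|y' + w| < `|y' + v|.
    by rewrite ltNge; apply/negP => /rS vw; exact/nAv/vw.
  (* The factors of [b ^ 2 - a ^ 2 > 0] have the same sign. *)
  have gap (a b : R) :
      `|a| < `|b| -> (a <= b -> 0 < a + b) /\ (b < a -> a + b < 0).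
    by case: (ger0P a) => ?; case: (ger0P b) => ? ab; split => ?; lra.
  move=> /gap[_ lt1] /gap[lt2 lt3]; case: (ltgtP v w) => [vw|wv|->//].
    have := lt2 (lerD (lexx y) (ltW vw)); have := lt1 ltac:(by rewrite ltrD2l).
    lra.
  have := lt3 ltac:(by rewrite ltrD2l) => ?.
  by rewrite [leRHS]ltr0_norm ?ler_norml; lra.
have [->|/eqP/set0P[w0 Dw0]] := pselect (A y' `\` A y = set0).
  by rewrite integral_set0 integral_ge0// => w _; rewrite lee_fin.
(* [sup F] separates the values: it is at least [f] on one difference and at most [f] on the other,
   and the two have equal measure. *)
pose F := [set f w | w in A y' `\` A y].
have F0 : F !=set0 by exists (f w0), w0.
apply: (@le_trans _ _ (\int[mu]_(w in A y' `\` A y) (cst (sup F)%:E) w)%E).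
  apply: ge0_le_integral; first exact: mD.
  - by move=> w _; rewrite lee_fin.
  - exact: (measurable_funTS mf).
  - exact: measurable_cst.
  move=> w Dw; rewrite lee_fin; apply: ub_le_sup; last by exists w.
  by exists (f v0) => _ [u Du <-]; exact: bnd.
have -> : (\int[mu]_(w in A y' `\` A y) (cst (sup F)%:E) w =
    \int[mu]_(w in A y `\` A y') (cst (sup F)%:E) w)%E.
  by rewrite !integral_cst; [congr (_ * _)%E; exact: muD|exact: mD|exact: mD].
apply: ge0_le_integral; first exact: mD.
- move=> w _; rewrite lee_fin (le_trans (f0 w0))//.
  apply: ub_le_sup; last by exists w0.
  by exists (f v0) => _ [u Du <-]; exact: bnd.
- exact: measurable_cst.
- exact: (measurable_funTS mf).
- by move=> v Dv; rewrite lee_fin; apply: ge_sup => // _ [w Dw <-]; exact: bnd.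
Qed.

Lemma pdf_radial_le (y y' : R) : `|y| <= `|y'| ->
  (\int[mu]_(w in A y') (f w)%:E <= \int[mu]_(w in A y) (f w)%:E)%E.
Proof.
have norm z :
    (\int[mu]_(w in A `|z|) (f w)%:E = \int[mu]_(w in A z) (f w)%:E)%E.
  by case: (ger0P z).
by move=> yy'; rewrite -(norm y) -(norm y'); exact: integral_ge0_le.
Qed.

End PdfNoise.

Lemma radial_set_int (S : set int) : radial_set S -> S = setT \/
  exists c : nat, forall z : int, S z <-> (`|z| < c)%N.
Proof.
move=> rS; have [ST|SNT] := pselect (forall z, S z).
  by left; apply/seteqP; split.
(* The bound [c] is the least natural number outside [S]. *)
right; have exc : exists c : nat, `[< ~ S c%:Z >].
  move/existsNP: SNT => [z nSz]; exists `|z|%N; apply/asboolP => Sz.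
  by apply: nSz; apply: rS Sz; rewrite abszE normr_id.
exists (ex_minn exc); case: ex_minnP => c /asboolP nSc minc z; split => [Sz|zc].
  rewrite ltnNge; apply/negP => cz; apply: nSc; apply: rS Sz.
  by rewrite -abszE -abszE; lia.
apply: (@rS _ `|z|%N); first by rewrite abszE normr_id.
by apply: contrapT => /asboolP /minc; lia.
Qed.

(** * Noise with a probability mass function *)

Section PmfNoise.
Context {R : realType} {d : measure_display} {Omega : measurableType d}
  {P : probability Omega R}.
Variables (W : Omega -> int) (f : int -> R).
Hypotheses (Wf : is_pmf_of P W f) (fu : symmetric_unimodal f).

(** [is_pmf_of] speaks of singletons only; countability of the integers gives the other sets. *)
Lemma pmf_measurable (S : set int) : measurable (W @^-1` S).
Proof.
rewrite (_ : _ @^-1` _ = \bigcup_k (W @^-1` [set l | S l /\ l = k]));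
  last first.
  by apply/seteqP; split => [w Sw|w [k _ []]//]; exists (W w).
apply: countable_bigcupT_measurable => // k; have [Sk|nSk] := pselect (S k).
  rewrite (_ : [set _ | _] = [set k]); first exact: (Wf k).1.
  by apply/seteqP; split => [l []//|l ->].
rewrite (_ : [set _ | _] = set0) ?preimage_set0//.
by apply/seteqP; split => [l [/[swap] ->]|].
Qed.

Lemma pmf_window (b : int) (m : nat) :
  P [set w | b <= W w < b + m%:Z] = (\sum_(i < m) f (b + i%:Z))%:E.
Proof.
pose F i := W @^-1` [set b + i%:Z].
rewrite (_ : [set _ | _] = \big[setU/set0]_(i < m) F i).
  rewrite measure_bigsetU; first 1 last.
  - by move=> i; exact: pmf_measurable.
  - by move=> i j _ _ [w []]; rewrite /F/= => -> /addrI[].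
  by rewrite -sumEFin; apply: eq_bigr => i _; exact: (Wf _).2.
rewrite -bigcup_mkord; apply/seteqP.
split=> [w /= bw|w [i /= im ->]]; last by lia.
by exists `|W w - b|%N; rewrite /F/=; lia.
Qed.

(** The integers [w] with [|y + w| < c] are the [2 c - 1] consecutive ones from [1 - c - y] on; at
    [c = 0] the truncated predecessor makes the sum empty. *)
Let G (c : nat) (y : int) := \sum_(i < c.*2.-1) f (1 - c%:Z - y + i%:Z).

Let pmf_ball (c : nat) (y : int) :
  P [set w | (`|(y + W w)%R| < c)%N] = (G c y)%:E.
Proof.
rewrite -pmf_window; congr (P _); apply/seteqP; split => w /=; lia.
Qed.

Let G_even c y : G c (- y) = G c y.
Proof.
have [fN _ _] := fu.
rewrite /G (reindex_inj rev_ord_inj)/=; apply: eq_bigr => i _.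
by rewrite -fN; congr f; have := ltn_ord i; lia.
Qed.

Let G_step c (k : nat) : G c k.+1%:Z <= G c k%:Z.
Proof.
rewrite /G; case: c => [|c]; first by rewrite !big_ord0.
have -> : c.+1.*2.-1 = c.*2.+1 by lia.
(* The window for [k + 1] gains the point [- c - k - 1] on the left and loses [c - k] on the right,
   and [|c - k| <= c + k + 1]. *)
rewrite big_ord_recl [leRHS]big_ord_recr [leRHS]addrC/= lerD//.
  by apply: symmetric_unimodal_le fu _; lia.
apply: ler_sum => i _; rewrite /bump/= le_eqVlt; apply/orP; left; apply/eqP.
by congr f; lia.
Qed.

Lemma pmf_radial_le (S : set int) (y y' : int) :
  radial_set S -> `|y| <= `|y'| ->
  (P [set w | S (y' + W w)%R] <= P [set w | S (y + W w)%R])%E.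
Proof.
move=> /radial_set_int[->//|[c Sc]] yy'.
have SE z : [set w | S (z + W w)] = [set w | (`|(z + W w)%R| < c)%N].
  by apply/seteqP; split => w /=; rewrite Sc.
have G_norm z : G c z = G c `|z|%N.
  by rewrite abszE; case: (ger0P z) => // _; rewrite G_even.
rewrite !SE !pmf_ball lee_fin (G_norm y) (G_norm y').
have : (`|y| <= `|y'|)%N by lia.
elim: `|y'|%N => [|k IH]; first by rewrite leqn0 => /eqP ->.
rewrite leq_eqVlt => /predU1P[->//|]; rewrite ltnS => /IH; apply: le_trans.
exact: G_step.
Qed.

End PmfNoise.

Lemma noise_radial_measurable {R : realType} {d : measure_display}
    {Omega : measurableType d} {P : probability Omega R} {x : alphabet}
    {W : Omega -> carrier R x} (S : set (carrier R x)) (y : carrier R x) :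
  symmetric_unimodal_noise P W -> radial_set S ->
  measurable [set w | S (y + W w)].
Proof.
case: x W S y => W S y /= [f Wf fu] rS.
  exact: (@pmf_measurable R d Omega P W f Wf [set k | S (y + k)]).
case: Wf => mW _ _ _; rewrite -[X in measurable X]setTI.
apply: (mW measurableT [set k | S (y + k)]).
by apply: is_interval_measurable; exact: radial_set_interval.
Qed.

Lemma noise_radial_le {R : realType} {d : measure_display}
    {Omega : measurableType d} {P : probability Omega R} {x : alphabet}
    {W : Omega -> carrier R x} (S : set (carrier R x)) (y y' : carrier R x) :
  symmetric_unimodal_noise P W -> radial_set S -> `|y| <= `|y'| ->
  (P [set w | S (y' + W w)%R] <= P [set w | S (y + W w)%R])%E.
Proof.
case: x W S y y' => W S y y' /= [f Wf fu] rS yy'.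
  exact: (@pmf_radial_le R d Omega P W f Wf fu).
case: Wf => mW fm f0 PW.
have PWE z : P [set w | S (z + W w)] =
    (\int[lebesgue_measure]_(w in [set w | S (z + w)%R]) (f w)%:E)%E.
  by apply: PW; apply: is_interval_measurable; exact: radial_set_interval.
by rewrite !PWE; exact: pdf_radial_le.
Qed.

(** * Functions of the absolute value, and dominance *)

(** Any ordered codomain is allowed, to cover value functions in [\bar R] as well as the distortion
    and the selected power level in [R]. *)
Definition radial_fun {X : realDomainType} {disp : Order.disp_t}
    {Y : porderType disp} (h : X -> Y) : Prop :=
  forall z z' : X, `|z| <= `|z'| -> (h z <= h z')%O.

Lemma radial_fun_even {X : realDomainType} {disp : Order.disp_t}
    {Y : porderType disp} (h : X -> Y) : radial_fun h -> even_fun h.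
Proof. by move=> rh z; apply/le_anti; rewrite !rh ?normrN. Qed.

Lemma radial_fun_quasi_convex {X : realDomainType} {disp : Order.disp_t}
    {Y : porderType disp} (h : X -> Y) : radial_fun h -> quasi_convex h.
Proof.
move=> rh r.
have rS : radial_set [set z | (h z <= r)%O].
  by move=> z z' /rh zz' /=; exact: le_trans.
have := radial_set_interval _ 0 rS; congr is_interval.
by apply/seteqP; split => z /=; rewrite add0r.
Qed.

(** [z] lies between [- |z'|] and [|z'|], where [h] takes the value [h z']. *)
Lemma even_quasi_convex_radial {X R : realDomainType} (h : X -> R) :
  even_fun h -> quasi_convex h -> radial_fun h.
Proof.
move=> hN hq z z' zz'.
have hnorm : h `|z'| = h z' by case: (ger0P z').
apply: (hq (h z') (- `|z'|) `|z'|) => //=; rewrite ?hN ?hnorm//.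
by rewrite -ler_norml.
Qed.

Section NoisyRadial.
Context {R : realType} {d : measure_display} {Omega : measurableType d}
  {P : probability Omega R} {x : alphabet} {W : Omega -> carrier R x}.
Hypothesis hW : symmetric_unimodal_noise P W.

Let sublevel (h : carrier R x -> \bar R) (r : R) := [set z | (h z <= r%:E)%E].

Let tailC h y (r : R) :
  [set w | (r%:E < h (y + W w)%R)%E] = ~` [set w | sublevel h r (y + W w)%R].
Proof. by apply/seteqP; split => w /=; rewrite /sublevel/= ltNge => /negP. Qed.

Let sublevel_radial h r : radial_fun h -> radial_set (sublevel h r).
Proof. by move=> rh z z' /rh zz'; exact: le_trans. Qed.

Let sublevel_measurable h y r : radial_fun h ->
  measurable [set w | sublevel h r (y + W w)%R].
Proof.
by move=> rh; exact: noise_radial_measurable _ y hW (sublevel_radial h r rh).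
Qed.

(** Measurability comes from the shape of [h]: its sublevel sets are radial. *)
Lemma radial_noise_measurable (h : carrier R x -> \bar R) y :
  radial_fun h -> measurable_fun setT (fun w => h (y + W w)).
Proof.
move=> rh; apply: (measurability _ (ErealGenOInfty.measurableE R)).
move=> _ [_ [r ->]] <-; rewrite setTI preimage_itvoy tailC.
by apply: measurableC; exact: sublevel_measurable.
Qed.

(* Anderson's inequality in dimension one. *)
Lemma radial_noise_integral_le (h : carrier R x -> \bar R) y y' :
  radial_fun h -> (forall z, 0 <= h z)%E -> `|y| <= `|y'| ->
  (\int[P]_w h (y + W w)%R <= \int[P]_w h (y' + W w)%R)%E.
Proof.
move=> rh h0 yy'.
apply: le_integral_tail => //; [exact: radial_noise_measurable..|move=> r].
rewrite !tailC !probability_setC; [|exact: sublevel_measurable..].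
by apply: leeB => //; exact: noise_radial_le (sublevel_radial h r rh) yy'.
Qed.

End NoisyRadial.

Section Dominance.
Context {R : realType}.
Local Open Scope ereal_scope.

(** Rearrangement of two terms. The weight [p] is split as [q + (p - q)], since [B - A] is of no use
    when both values are +oo. *)
Lemma lee_swap (q p : R) (A B : \bar R) : (0 <= q)%R -> (q <= p)%R ->
  0 <= A -> A <= B -> p%:E * A + q%:E * B <= q%:E * A + p%:E * B.
Proof.
move=> q0 qp A0 AB; have B0 := le_trans A0 AB.
have pE C : 0 <= C -> p%:E * C = q%:E * C + (p - q)%:E * C.
  by move=> C0; rewrite -ge0_muleDl ?lee_fin ?subr_ge0// -EFinD subrKC.
rewrite (pE A)// (pE B)// -addeA leeD2l// addeC leeD2l//.
by apply: lee_wpmul2l => //; rewrite lee_fin subr_ge0.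
Qed.

(** The weight [p - q] moves from the smaller value [B] to the larger value [A]. With [A] the cost
    after a drop and [B] the cost after a reception, this makes the stage cost increase with the
    drop probability. *)
Lemma lee_convex_weight (q p : R) (A B : \bar R) : (0 <= q)%R -> (q <= p)%R ->
  (p <= 1)%R -> 0 <= B -> B <= A ->
  q%:E * A + (1 - q)%:E * B <= p%:E * A + (1 - p)%:E * B.
Proof.
move=> q0 qp p1 B0 BA; have A0 := le_trans B0 BA.
rewrite (_ : p%:E * A = q%:E * A + (p - q)%:E * A); last first.
  by rewrite -ge0_muleDl ?lee_fin ?subr_ge0// -EFinD subrKC.
rewrite -addeA leeD2l// (_ : (1 - q)%:E * B = (p - q)%:E * B + (1 - p)%:E * B).
  by rewrite leeD2r//; apply: lee_wpmul2l => //; rewrite lee_fin subr_ge0.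
by rewrite -ge0_muleDl ?lee_fin ?subr_ge0// -EFinD; congr (_%:E * _); ring.
Qed.

(* Abel summation, arranged with nonnegative weights only, since g may take the
   value +oo. *)
Lemma lee_sum_dominated (a b : nat -> R) (g : nat -> \bar R) (m : nat)
    (y : \bar R) :
  (forall k, 0 <= a k)%R -> (forall k, 0 <= b k)%R ->
  (forall j, (j <= m)%N -> (\sum_(k < j) a k <= \sum_(k < j) b k)%R) ->
  (forall j k, (j <= k < m)%N -> g k <= g j) ->
  0 <= y -> (forall k, (k < m)%N -> y <= g k) ->
  \sum_(k < m) (a k)%:E * g k +
    (\sum_(k < m) b k - \sum_(k < m) a k)%R%:E * y <=
  \sum_(k < m) (b k)%:E * g k.
Proof.
move=> a0 b0; elim: m y => [|m IH] y ab gd y0 yg.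
  by rewrite !big_ord0 subrr mul0e adde0.
have gm : 0 <= g m by rewrite (le_trans y0)// yg.
have ab_ge0 j : (j <= m.+1)%N ->
    0 <= (\sum_(k < j) b k - \sum_(k < j) a k)%R%:E.
  by move=> jm; rewrite lee_fin subr_ge0 ab.
rewrite [leRHS]big_ord_recr/=.
apply: le_trans; last first.
  (* The surplus of [b] over [a] before [m] is valued at [g m], the least value so far. Together
     with the terms of index [m] it becomes the surplus up to [m + 1], worth at least [y] per
     unit. *)
  apply: leeD2r; apply: (IH (g m)) => //.
  - by move=> j jm; apply: ab; exact: leqW.
  - by move=> j k /andP[jk km]; apply: gd; rewrite jk leqW.
  - by move=> k km; apply: gd; rewrite (ltnW km) ltnS leqnn.
rewrite big_ord_recr/= -!addeA leeD2l//.
rewrite -[leRHS]ge0_muleDl ?lee_fin//; last by rewrite -lee_fin ab_ge0.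
apply: (@le_trans _ _ ((a m)%:E * g m +
    (\sum_(k < m.+1) b k - \sum_(k < m.+1) a k)%R%:E * g m)).
  by rewrite leeD2l//; apply: lee_wpmul2l; [exact: ab_ge0|exact: yg].
rewrite -ge0_muleDl ?lee_fin//; last by rewrite -lee_fin ab_ge0.
by rewrite le_eqVlt; apply/orP; left; apply/eqP; congr (_ * _); congr EFin;
  rewrite !big_ord_recr/=; ring.
Qed.

(** Both rows have mass 1, so the larger tails of row [s'] mean smaller initial sums, as Abel
    summation requires. *)
Lemma stochastically_monotone_le (n : nat) (Q : 'M[R]_n) (g : 'I_n -> \bar R)
    (s s' : 'I_n) :
  transition_matrix Q -> stochastically_monotone Q -> (s <= s')%N ->
  (forall k, 0 <= g k) -> (forall j k : 'I_n, (j <= k)%N -> g k <= g j) ->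
  \sum_(k < n) (Q s' k)%:E * g k <= \sum_(k < n) (Q s k)%:E * g k.
Proof.
move=> [Q0 Q1] mQ; rewrite leq_eqVlt => /predU1P[/val_inj ->//|ss'] g0 gd.
case: n Q g s s' Q0 Q1 mQ ss' g0 gd => [_ _ []//|n] Q g s s' Q0 Q1 mQ ss' g0 gd.
(* Beyond the range [inord] returns state 0, so the extended row stays nonnegative. *)
pose q i k := Q i (inord k).
have sumE i : \sum_(k < n.+1) (Q i k)%:E * g k =
    \sum_(k < n.+1) (q i k)%:E * g (inord k).
  by apply: eq_bigr => k _; rewrite /q inord_val.
have headE i j : (j <= n.+1)%N ->
    (\sum_(k < j) q i k = 1 - \sum_(k < n.+1 | (j <= k)%N) Q i k)%R.
  move=> jn; rewrite (big_ord_widen _ (q i) jn) -(Q1 i).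
  rewrite [in RHS](bigID (fun k : 'I__ => (k < j)%N)) /=.
  rewrite [X in (_ = _ + X - _)%R](eq_bigl (fun k : 'I_n.+1 => (j <= k)%N)).
    by rewrite addrK; apply: eq_bigr => k _; rewrite /q inord_val.
  by move=> k; rewrite -leqNgt.
rewrite !sumE.
have := @lee_sum_dominated (q s') (q s) (fun k => g (inord k)) n.+1 0.
rewrite mule0 adde0; apply => //.
- by move=> k; exact: Q0.
- by move=> k; exact: Q0.
- move=> j jn; rewrite !headE// lerB//.
  (* Monotonicity of [Q] concerns tails starting at a state; the tail starting past the last state
     is empty. *)
  move: jn; rewrite leq_eqVlt => /predU1P[->|jn].
    by rewrite !big1// => k; rewrite leqNgt ltn_ord.
  exact: (mQ _ _ ss' (Ordinal jn)).
- move=> j k /andP[jk kn]; apply: gd; rewrite !inordK//.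
  exact: leq_ltn_trans kn.
Qed.

End Dominance.

(** * Dynamic programming *)

Lemma power_levels_max {R : realType} {U : set R} : power_levels U ->
  exists2 umax, U umax & forall u, U u -> u <= umax.
Proof.
case=> [[umax umax0 ->]|[/finite_seqP[s sU] U0 _]].
  exists umax; first by rewrite /= in_itv/= umax0 lexx.
  by move=> u; rewrite /= in_itv/= => /andP[].
have smax (x : R) : exists2 m, m \in x :: s & forall u, u \in x :: s -> u <= m.
  elim: s {sU} x => [|y s IH] x.
    by exists x; rewrite ?inE// => u; rewrite inE => /eqP ->.
  have [m my um] := IH y; exists (Num.max x m).
    by rewrite /Num.max; case: ifP => _; rewrite inE ?my ?eqxx ?orbT.
  move=> u; rewrite inE.
  by move=> /predU1P[->|/um um']; rewrite le_max ?lexx ?um' ?orbT.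
have [m ms um] := smax 0; have s0 : 0 \in s by move: U0; rewrite sU.
exists m; first by move: ms; rewrite sU inE => /predU1P[->|].
by move=> u; rewrite sU => us; apply: um; rewrite inE [u \in s]us orbT.
Qed.

Lemma power_levels_0 {R : realType} {U : set R} : power_levels U ->
  U 0 /\ forall u, U u -> 0 <= u.
Proof.
case=> [[umax umax0 ->]|[]//]; split => [|u]; rewrite /= in_itv/= ?lexx//.
by case/andP.
Qed.

(* Neither the least nor the greatest minimizer need exist. But two minimizers
   selected at e and e' in the wrong order would both be minimizers at e and at
   e', by submodularity; so selecting the least minimizer for a well-order of
   the reals, unrelated to the usual order, is monotone. Where H e is
   identically +oo, submodularity is void and the largest level is selected. *)
Lemma submodular_radial_selection {R : realType} {X : realDomainType}
    (U : set R) (H : X -> R -> \bar R) (umax : R) :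
  U umax -> (forall u, U u -> u <= umax) ->
  (forall e u, U u -> 0 <= H e u)%E ->
  (forall u, U u -> radial_fun (H^~ u)) ->
  (forall e e' u v, U u -> U v -> (v <= u)%R -> (`|e| <= `|e'|)%R ->
     H e v + H e' u <= H e u + H e' v)%E ->
  (forall e, exists u, is_arg_min U (H e) u) ->
  exists2 f : X -> R, forall e, is_arg_min U (H e) (f e) & radial_fun f.
Proof.
move=> Umax maxU H0 Hrad Hsub Hmin.
have [prec wo_prec] := well_ordering_principle R.
pose infinite e := forall u, U u -> H e u = +oo%E.
have /choice[f fP] e : exists u, [/\ is_arg_min U (H e) u,
    infinite e -> u = umax
  & ~ infinite e -> forall v, is_arg_min U (H e) v -> prec u v].
  have [ie|nie] := pselect (infinite e).
    exists umax; split => //; split => // v Uv.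
    by rewrite !ie.
  have [|u [[Mu lbu] _]] := wo_prec [pred u | `[< is_arg_min U (H e) u >]].
    by have [u Mu] := Hmin e; exists u; exact/asboolP.
  exists u; split => //; first exact/asboolP.
  by move=> _ v Mv; apply: lbu; exact/asboolP.
exists f; first by move=> e; have [] := fP e.
move=> e e' ee'.
have [[Ue mine] _ prece] := fP e; have [[Ue' mine'] infe' prece'] := fP e'.
have [ie'|nie'] := pselect (infinite e'); first by rewrite infe'// maxU.
have nie : ~ infinite e.
  move=> ie; apply: nie' => u Uu; apply/eqP; rewrite -leye_eq -(ie u Uu).
  exact: Hrad.
have fin z g : ~ infinite z -> is_arg_min U (H z) g -> H z g \is a fin_num.
  move=> niz [Ug ming]; rewrite ge0_fin_numE ?H0// ltNge leye_eq.
  apply/negP => /eqP zoo.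
  by apply: niz => u Uu; apply/eqP; rewrite -leye_eq -zoo ming.
have fe := fin _ _ nie (conj Ue mine).
have fe' := fin _ _ nie' (conj Ue' mine').
rewrite leNgt; apply/negP => lt_fe'.
have sub := Hsub e e' (f e) (f e') Ue Ue' (ltW lt_fe') ee'.
have Me : is_arg_min U (H e) (f e').
  split=> // v Uv; apply: le_trans (mine v Uv).
  rewrite leNgt; apply/negP => lte; move: sub; rewrite leNgt => /negP; apply.
  exact: lte_leD lte (mine' _ Ue).
have Me' : is_arg_min U (H e') (f e).
  split=> // v Uv; apply: le_trans (mine' v Uv).
  rewrite leNgt; apply/negP => lte'; move: sub; rewrite leNgt => /negP; apply.
  exact: lee_ltD (mine _ Ue') lte'.
(* Each of [f e] and [f e'] now precedes the other, so both are the least element of this pair,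
   which is unique. *)
have [|z [_ uniq_z]] := wo_prec (pred2 (f e) (f e')).
  by exists (f e); rewrite inE eqxx.
have ze : z = f e.
  apply: uniq_z; split; first by rewrite inE eqxx.
  by move=> v; rewrite inE => /pred2P[] ->; exact: prece.
have ze' : z = f e'.
  apply: uniq_z; split; first by rewrite inE eqxx orbT.
  by move=> v; rewrite inE => /pred2P[] ->; exact: prece'.
by move: lt_fe'; rewrite -ze -ze' ltxx.
Qed.

(** * One Bellman step, and induction on the horizon *)

Section Bellman.
Context {R : realType} {x : alphabet} {n : nat} {U : set R}
  {d : measure_display} {Omega : measurableType d} {P : probability Omega R}
  {a : carrier R x} {W : Omega -> carrier R x} {Q : 'M[R]_n}
  {p : 'I_n -> R -> R} {lambda : R -> R} {dist : carrier R x -> R}.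
Hypotheses (hW : symmetric_unimodal_noise P W) (hU : power_levels U)
  (hQ : transition_matrix Q) (hp : drop_probability U p)
  (hlambda : transmission_cost U lambda) (hdist : distortion dist).

Let dist_radial : radial_fun dist.
Proof. by case: hdist => dN dq _; exact: even_quasi_convex_radial. Qed.

Let dist_ge0 e : 0 <= dist e.
Proof. by case: hdist => _ _ <-; apply: dist_radial; rewrite normr0. Qed.

Let p_ge0 s u : U u -> 0 <= p s u.
Proof. by case: hp => p01 _ _ _ /(p01 s)/andP[]. Qed.

Let p_le1 s u : U u -> p s u <= 1.
Proof. by case: hp => p01 _ _ _ /(p01 s)/andP[]. Qed.

Let Q_ge0 s s' : (0 <= (Q s s')%:E)%E.
Proof. by rewrite lee_fin; exact: hQ.1. Qed.

Section Step.
Variable J : carrier R x -> 'I_n -> \bar R.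
Hypotheses (J_ge0 : forall e s, (0 <= J e s)%E)
  (J_radial : forall s, radial_fun (J^~ s)).

Local Notation H := (bellman P a W Q p lambda dist J).

Let lost e s := (\int[P]_w J (a * e + W w)%R s)%E.
Let received s := (\int[P]_w J (W w) s)%E.
Let term e u s := ((p s u * dist e)%R%:E + (p s u)%:E * lost e s +
  (1 - p s u)%R%:E * received s)%E.

Let HE e s u : H e s u =
  ((lambda u)%:E + \sum_(s' < n) (Q s s')%:E * term e u s')%E.
Proof. by []. Qed.

Let lost_ge0 e s : (0 <= lost e s)%E.
Proof. exact: integral_ge0. Qed.

Let received_ge0 s : (0 <= received s)%E.
Proof. exact: integral_ge0. Qed.

Let lost_radial s : radial_fun (lost^~ s).
Proof.
move=> e e' ee'; apply: (radial_noise_integral_le hW (J^~ s)) => //.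
by rewrite !normrM ler_wpM2l.
Qed.

Let receivedE s : received s = (\int[P]_w J (0 + W w)%R s)%E.
Proof. by apply: eq_integral => w _; rewrite add0r. Qed.

(** A reception resets the error to 0, where the noisy average is smallest. *)
Let received_le_lost e s : (received s <= lost e s)%E.
Proof.
rewrite receivedE; apply: (radial_noise_integral_le hW (J^~ s)) => //.
by rewrite normr0.
Qed.

Let term_ge0 e u s : U u -> (0 <= term e u s)%E.
Proof.
move=> Uu; rewrite !adde_ge0//.
- by rewrite lee_fin mulr_ge0// p_ge0.
- by rewrite mule_ge0// lee_fin p_ge0.
- by rewrite mule_ge0// lee_fin subr_ge0 p_le1.
Qed.

Lemma bellman_ge0 e s u : U u -> (0 <= H e s u)%E.
Proof.
move=> Uu; rewrite HE adde_ge0//.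
  have [U0 u0] := power_levels_0 hU; case: hlambda => lmono l0.
  by rewrite lee_fin -l0 lmono// u0.
by apply: sume_ge0 => s' _; rewrite mule_ge0// term_ge0.
Qed.

Lemma bellman_radial s u : U u -> radial_fun (fun e => H e s u).
Proof.
move=> Uu e e' ee'; rewrite !HE leeD2l//; apply: lee_sum => s' _.
apply: lee_wpmul2l => //; rewrite leeD2r// leeD//.
  by rewrite lee_fin ler_wpM2l// ?p_ge0// dist_radial.
by apply: lee_wpmul2l; [rewrite lee_fin p_ge0|exact: lost_radial].
Qed.

(** The power cost and the reception terms without [e] are common to both sides. What remains is
    [p s' u], nonincreasing in [u], times quantities nondecreasing in [|e|], so rearrangement
    applies. *)
Lemma bellman_submodular s e e' u v :
  U u -> U v -> v <= u -> `|e| <= `|e'| ->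
  (H e s v + H e' s u <= H e s u + H e' s v)%E.
Proof.
move=> Uu Uv vu ee'; rewrite !HE.
rewrite addeACA [leRHS]addeACA [(lambda v)%:E + _]addeC leeD2l//.
rewrite -!big_split/=; apply: lee_sum => s' _.
rewrite -!ge0_muleDr ?term_ge0//; apply: lee_wpmul2l => //.
rewrite /term addeACA [leRHS]addeACA [X in (_ <= _ + X)%E]addeC leeD2r//.
have pvu : p s' u <= p s' v by case: hp => _ pmono _ _; exact: pmono.
rewrite addeACA [leRHS]addeACA leeD//.
  rewrite -!EFinD lee_fin; have := dist_radial _ _ ee'; nra.
by apply: lee_swap => //; [exact: p_ge0|exact: lost_radial].
Qed.

Hypothesis mQ : stochastically_monotone Q.
Hypothesis J_nonincreasing :
  forall e (s s' : 'I_n), (s <= s')%N -> (J e s' <= J e s)%E.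

Lemma bellman_nonincreasing e (s s' : 'I_n) u : U u -> (s <= s')%N ->
  (H e s' u <= H e s u)%E.
Proof.
move=> Uu ss'; rewrite !HE leeD2l//.
apply: stochastically_monotone_le => // [k|j k jk]; first exact: term_ge0.
have pjk : p k u <= p j u by case: hp => _ _ pmono _; exact: pmono.
rewrite /term -!addeA leeD//.
  by rewrite lee_fin ler_wpM2r.
(* Two moves: with the weights of the better state [k] kept, the future costs are replaced by those
   of [j]; then the drop probability is raised to that of [j]. *)
apply: (le_trans _ (lee_convex_weight _ _ _ _ (p_ge0 k u Uu) pjk
  (p_le1 j u Uu) (received_ge0 j) (received_le_lost e j))).
have mJ y l : measurable_fun setT (fun w => J (y + W w) l).
  exact: (radial_noise_measurable hW (J^~ l)).
apply: leeD; apply: lee_wpmul2l; rewrite ?lee_fin ?p_ge0 ?subr_ge0 ?p_le1//.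
  by apply: ge0_le_integral => // w _; exact: J_nonincreasing.
by rewrite !receivedE; apply: ge0_le_integral => // w _; exact: J_nonincreasing.
Qed.

End Step.

Local Notation V := (cost_to_go U P a W Q p lambda dist).

(** The induction carries both properties because the averaging inequality asks for nonnegative
    functions. An infimum of functions nondecreasing in [|e|] is again nondecreasing in [|e|]. *)
Lemma cost_to_go_ge0_radial k :
  (forall e s, (0 <= V k e s)%E) /\ (forall s, radial_fun ((V k)^~ s)).
Proof.
elim: k => [|k [V0 Vr]]; first by split=> [e s|s z z' _] //=.
split=> [e s|s e e' ee'] /=.
  by apply: le_ereal_inf_tmp => _ [u Uu <-]; exact: (bellman_ge0 _ V0).
apply: le_ereal_inf_tmp => _ [u Uu <-].
apply: le_trans (bellman_radial _ V0 Vr s _ Uu _ _ ee').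
by apply: ereal_inf_lbound; exists u.
Qed.

Lemma cost_to_go_nonincreasing k : stochastically_monotone Q ->
  forall e (s s' : 'I_n), (s <= s')%N -> (V k e s' <= V k e s)%E.
Proof.
move=> mQ; elim: k => [|k IH] e s s' ss' //=.
have [V0 Vr] := cost_to_go_ge0_radial k.
apply: le_ereal_inf_tmp => _ [u Uu <-].
apply: le_trans (bellman_nonincreasing _ V0 Vr mQ IH e _ _ _ Uu ss').
by apply: ereal_inf_lbound; exists u.
Qed.

End Bellman.

Theorem theorem3 (R : realType) (x : alphabet) (n : nat)
    (U : set R) (disp : measure_display) (Omega : measurableType disp)
    (P : probability Omega R) (a : carrier R x) (W : Omega -> carrier R x)
    (Q : 'M[R]_n) (p : 'I_n -> R -> R) (lambda : R -> R)
    (dist : carrier R x -> R) (T : nat)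
    (hW : symmetric_unimodal_noise P W)
    (hU : power_levels U)
    (hQ : transition_matrix Q)
    (hp : drop_probability U p)
    (hlambda : transmission_cost U lambda)
    (hdist : distortion dist)
    (hmin : forall (t : nat) e s, (t <= T)%N ->
       exists u, is_arg_min U (objective U P a W Q p lambda dist T t e s) u)
    (t : nat) (ht : (t <= T)%N) :
  let J := value_function U P a W Q p lambda dist T t in
  (forall s : 'I_n, even_fun (J^~ s) /\ quasi_convex (J^~ s)) /\
  (stochastically_monotone Q ->
     (forall e (s s' : 'I_n), (s <= s')%N -> (J e s' <= J e s)%E) /\
     (exists f : carrier R x -> 'I_n -> R,
        (forall e s,
           is_arg_min U (objective U P a W Q p lambda dist T t e s) (f e s)) /\
        (forall s : 'I_n, even_fun (f^~ s) /\ quasi_convex (f^~ s)))).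
Proof.
have V0r k :=
  @cost_to_go_ge0_radial _ _ _ _ _ _ _ a _ _ _ _ _ hW hU hQ hp hlambda hdist k.
move=> J; split=> [s|mQ].
  have [_ /(_ s) Jr] := V0r (T.+1 - t)%N.
  by split; [exact: radial_fun_even|exact: radial_fun_quasi_convex].
split; first exact: cost_to_go_nonincreasing.
(* The objective at time [t] is built on the value function at time [t + 1], hence the shifted
   horizon. *)
have [V0 Vr] := V0r (T.+1 - t.+1)%N.
have [umax Umax maxU] := power_levels_max hU.
have /choice[f fP] s : exists f : carrier R x -> R, (forall e,
    is_arg_min U (objective U P a W Q p lambda dist T t e s) (f e)) /\
    radial_fun f.
  have [||||||f fmin fr] := @submodular_radial_selection R (carrier R x) U
    (fun e => objective U P a W Q p lambda dist T t e s) umax => //.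
  - by move=> e u; apply: bellman_ge0.
  - by move=> u; apply: bellman_radial.
  - by move=> e e' u v; apply: bellman_submodular.
  - by move=> e; exact: hmin.
  - by exists f.
exists (fun e s => f s e); split=> [e s|s]; first by have [] := fP s.
have [_ fr] := fP s.
by split; [exact: radial_fun_even|exact: radial_fun_quasi_convex].
Qed.
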